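(* Let $\mathcal F$ be a finite, degenerate family of graphs satisfying $\mathrm{ex}(n,\mathcal F)=O(n^{1+\alpha})$ for some constant $\alpha\in[0,1)$, and $\tau(\mathcal F)\ge 2$. Let $p>\frac{1}{1-\alpha}$ be a real number. Then there exists $n_0=n_0(\mathcal F,p)$ such that the following holds for all $n\ge n_0$. If $G$ is an $\mathcal F$-free graph on $n$ vertices with $e_p(G)=\mathrm{ex}_p(n,\mathcal F)$, then $G$ contains the complete bipartite graph $K_{\tau(\mathcal F)-1,\,n-\tau(\mathcal F)+1}$ as a subgraph.
   Context: All graphs are finite, simple and undirected; subgraphs need not be induced. For a family $\mathcal F$ of graphs, $G$ is $\mathcal F$-free if $G$ contains no $F\in\mathcal F$ as a subgraph. $\mathrm{ex}(n,\mathcal F)$ is the maximum number of edges of an $\mathcal F$-free graph on $n$ vertices. For real $p>0$, $e_p(G)=\sum_{v\in V(G)}d_G(v)^p$, and $\mathrm{ex}_p(n,\mathcal F)$ is the maximum of $e_p(G)$ over all $\mathcal F$-free graphs $G$ on $n$ vertices. A family $\mathcal F$ is degenerate if at least one graph in $\mathcal F$ is bipartite. For a bipartite graph $F$, an independent vertex cover of $F$ is an independent set of vertices that meets every edge of $F$, and $\tau(F)$ is the minimum size of an independent vertex cover of $F$. For a degenerate family, $\tau(\mathcal F)=\min\{\tau(F):F\in\mathcal F\text{ is bipartite}\}$. *)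

(* Defs.v *)
From HB Require Import structures.
From mathcomp Require Import all_boot all_order all_algebra.
From mathcomp Require Import all_classical all_reals all_analysis.

Set Implicit Arguments.
Unset Strict Implicit.
Unset Printing Implicit Defensive.

Import Order.TTheory GRing.Theory Num.Theory.
Import numFieldNormedType.Exports.

Local Open Scope ring_scope.

(* A simple graph on the vertex set T is a set of two-element subsets of T. *)
Record sgraph (T : finType) := SGraph {
  edges :> {set {set T}};
  _ : [forall e in edges, #|e| == 2%N] }.

HB.instance Definition _ (T : finType) := [isSub for @edges T].
HB.instance Definition _ (T : finType) := [Finite of sgraph T by <:].

(* Every finite graph is isomorphic to one on some 'I_n; using these labelled
   representatives makes finite families plain sequences over an eqType. *)
Definition graph := {n : nat & sgraph 'I_n}.

Section Graphs.
Variable T : finType.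
Implicit Types (G : sgraph T) (A : {set T}).

(* No condition x != y is needed: [set x; x] is a singleton, never an edge. *)
Definition adj G (x y : T) : bool := [set x; y] \in edges G.

Definition degree G (v : T) : nat := #|[set w | adj G v w]|.

Definition bipartite G : bool :=
  [exists c : {ffun T -> bool},
    [forall x, forall y, adj G x y ==> (c x != c y)]].

Definition independent G A : bool :=
  [forall x in A, forall y in A, ~~ adj G x y].

Definition vertex_cover G A : bool :=
  [forall e in edges G, ~~ [disjoint e & A]].

Definition ind_cover G A : bool := independent G A && vertex_cover G A.

(* The default #|T| of the minimum bounds every #|A|, so this is the true
   minimum as soon as an independent vertex cover exists (see tauP). *)
Definition tau G : nat := \big[minn/#|T|]_(A | ind_cover G A) #|A|.

End Graphs.

Definition contains (S T : finType) (H : sgraph S) (G : sgraph T) : bool :=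
  [exists f : {ffun S -> T}, injectiveb f &&
    [forall x, forall y, adj H x y ==> adj G (f x) (f y)]].

Definition family_free (F : seq graph) (T : finType) (G : sgraph T) : bool :=
  all (fun H : graph => ~~ contains (tagged H) G) F.

Definition ex_num (n : nat) (F : seq graph) : nat :=
  (\max_(G : sgraph 'I_n | family_free F G) #|edges G|)%N.

Definition degree_power (R : realType) (p : R) (T : finType) (G : sgraph T)
    : R :=
  \sum_(v : T) (degree G v)%:R `^ p.

(* Degree powers are nonnegative, so the default 0 does not affect the
   maximum. *)
Definition ex_pow (R : realType) (p : R) (n : nat) (F : seq graph) : R :=
  \big[Num.max/0]_(G : sgraph 'I_n | family_free F G) degree_power p G.

Definition degenerate (F : seq graph) : bool :=
  has (fun H : graph => bipartite (tagged H)) F.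

(* The default is an upper bound, hence irrelevant for a degenerate family
   (see tau_familyP). *)
Definition tau_family (F : seq graph) : nat :=
  \big[minn/(\max_(H <- F) tau (tagged H))%N]_(H <- F | bipartite (tagged H))
    tau (tagged H).

Definition Kbip_edges (s t : nat) : {set {set 'I_s + 'I_t}} :=
  [set [set inl x; inr y] | x : 'I_s, y : 'I_t].

Fact Kbip_subproof (s t : nat) : [forall e in Kbip_edges s t, #|e| == 2%N].
Proof.
by apply/forall_inP => e /imset2P[x y _ _ ->]; rewrite cards2.
Qed.

Definition Kbip (s t : nat) : sgraph ('I_s + 'I_t)%type :=
  SGraph (Kbip_subproof s t).

Lemma bigminn_seqP (I : eqType) (r : seq I) (P : pred I) (f : I -> nat) d :
  (forall i, i \in r -> P i -> (f i <= d)%N) -> has P r ->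
  exists2 i, (i \in r) && P i &
    \big[minn/d]_(j <- r | P j) f j = f i /\
    (forall j, j \in r -> P j -> (f i <= f j)%N).
Proof.
elim: r => [//|a r IH] hd.
have hd' i : i \in r -> P i -> (f i <= d)%N.
  by move=> ir; apply: hd; rewrite inE ir orbT.
rewrite big_cons /=; case Pa: (P a) => /=; last first.
  move=> /(IH hd')[i /andP[ir Pi] [-> m]].
  exists i; first by rewrite inE ir orbT.
  by split=> // j; rewrite inE => /orP[/eqP ->|]; [rewrite Pa|exact: m].
move=> _; case hr: (has P r).
  have [i /andP[ir Pi] [-> m]] := IH hd' hr.
  have [le|lt] := leqP (f a) (f i).
    exists a; first by rewrite inE eqxx.
    split=> // j; rewrite inE => /orP[/eqP -> //|jr Pj].
    exact: leq_trans le (m j jr Pj).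
  exists i; first by rewrite inE ir orbT.
  split=> // j; rewrite inE => /orP[/eqP -> _|]; [exact: ltnW|exact: m].
have nP j : j \in r -> P j = false by move/hasPn: hr => /(_ j) h /h/negbTE.
rewrite big_seq_cond big_pred0 => [|j]; last by apply/andP => -[/nP ->].
exists a; first by rewrite inE eqxx.
split; first by apply/minn_idPl/hd; rewrite ?inE ?eqxx.
by move=> j; rewrite inE => /orP[/eqP -> //|/nP ->].
Qed.

Lemma adjC (T : finType) (G : sgraph T) : symmetric (adj G).
Proof. by move=> x y; rewrite /adj finset.setUC. Qed.

Lemma adj_irr (T : finType) (G : sgraph T) : irreflexive (adj G).
Proof.
move=> x; apply/negbTE/negP; case: G => E /forall_inP EP /EP.
by rewrite cards2 eqxx.
Qed.

Lemma bipartite_ind_cover (T : finType) (G : sgraph T) :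
  bipartite G -> exists A, ind_cover G A.
Proof.
move=> /existsP[c /forallP cP].
have cP' x y : adj G x y -> c x != c y by move/forallP: (cP x) => /(_ y)/implyP.
exists [set x | c x]; apply/andP; split.
  apply/forall_inP => x; rewrite inE => cx; apply/forall_inP => y.
  by rewrite inE => cy; apply/negP => /cP'; rewrite cx cy.
apply/forall_inP => e eG.
have /cards2P[x [y [_ exy]]] : #|e| == 2%N.
  by move: (G) eG => -[E /forall_inP EP] /EP.
have /cP' : adj G x y by rewrite /adj -exy.
move=> cxy; rewrite disjoint_subset; apply/subsetPn; case cx: (c x).
  by exists x; [rewrite exy set21|rewrite !inE cx].
by exists y; [rewrite exy set22|move: cxy; rewrite !inE cx; case: (c y)].
Qed.

Lemma tauP (T : finType) (G : sgraph T) : bipartite G ->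
  exists2 A, ind_cover G A &
    tau G = #|A| /\ (forall B, ind_cover G B -> (#|A| <= #|B|)%N).
Proof.
move=> /bipartite_ind_cover[A0 hA0].
have [||A /andP[_ hA] [e m]] := @bigminn_seqP {set T} (index_enum {set T})
  (ind_cover G) (fun A => #|A|) #|T|.
- by move=> A _ _; exact: max_card.
- by apply/hasP; exists A0 => //; exact: mem_index_enum.
by exists A => //; split => // B; apply: m; exact: mem_index_enum.
Qed.

Lemma tau_familyP (F : seq graph) : degenerate F ->
  exists2 H : graph, (H \in F) && bipartite (tagged H) &
    tau_family F = tau (tagged H) /\
    (forall H' : graph, H' \in F -> bipartite (tagged H') ->
       (tau (tagged H) <= tau (tagged H'))%N).
Proof.
move=> degF; apply: bigminn_seqP degF => H HF _.
exact: (leq_bigmax_seq (F := fun H : graph => tau (tagged H))).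
Qed.

Lemma ex_powP (R : realType) (p : R) (n : nat) (F : seq graph)
    (G : sgraph 'I_n) : family_free F G ->
  degree_power p G = ex_pow p n F <->
  (forall G' : sgraph 'I_n, family_free F G' ->
     degree_power p G' <= degree_power p G).
Proof.
move=> fG; split=> [-> G' fG'|h]; first exact: le_bigmax_cond.
apply/eqP; rewrite eq_le; apply/andP; split; first exact: le_bigmax_cond.
by apply/bigmax_leP; split=> //; apply: sumr_ge0 => v _; exact: powR_ge0.
Qed.

(* Main.v *)
Require Import Defs.
From HB Require Import structures.
From mathcomp Require Import all_boot all_order all_algebra.
From mathcomp Require Import all_classical all_reals all_analysis.
From mathcomp Require Import perm zify ring lra.

(* Write t = tau(F) - 1. Uniting any set of a vertices with a well-chosen set of
   a vertices and applying ex(m, F) = O(m^(1+alpha)) to the graph they induce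
   shows that the first set has a vertex of degree O(n a^(alpha - 1)).
   Summing over the greedy ordering, e_q(G) = O(n^q) for
   every q > 1/(1 - alpha), so the vertices of degree o(n) are negligible in
   e_p(G). Since t + 1 vertices have O(1) common neighbours, comparing e_p(G)
   with e_p(K_{t,n-t}) yields a set A of t vertices of degree (1 - o(1)) n.
   If v lies outside A and misses some u in A, replacing all edges at v by the
   edges from v to A keeps the graph F-free, because a copy using v can use an
   unused common neighbour of A instead. Extremality then bounds the gain
   d(u)^(p-1) by the loss; summing over the set B of all such v, whose induced
   graph again satisfies the O(|B|^p) bound with |B| a small fraction of n,
   is contradictory unless B is empty. *)

Set Implicit Arguments.
Unset Strict Implicit.
Unset Printing Implicit Defensive.

Import Order.TTheory GRing.Theory Num.Theory.
Import numFieldNormedType.Exports.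

(** * Counting edges *)

Section RelGraph.
Variables (T : finType) (r : rel T).

Definition rel_edges : {set {set T}} :=
  [set e : {set T} | [exists x, exists y, [&& x != y, r x y & e == [set x; y]]]].

Fact rel_edges_subproof : [forall e in rel_edges, #|e| == 2].
Proof.
apply/forall_inP => e; rewrite inE => /existsP[x /existsP[y /and3P[xy _ /eqP->]]].
by rewrite cards2 xy.
Qed.

Definition graph_of_rel : sgraph T := SGraph rel_edges_subproof.

Lemma adj_graph_of_rel : symmetric r -> irreflexive r -> adj graph_of_rel =2 r.
Proof.
move=> rC rr x y; rewrite /adj /= inE; apply/idP/idP => [|rxy].
  move=> /existsP[a /existsP[b /and3P[ab rab /eqP e]]].
  have : x \in [set a; b] by rewrite -e set21.
  have : y \in [set a; b] by rewrite -e set22.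
  rewrite !inE => /orP[]/eqP yE /orP[]/eqP xE; rewrite xE yE //.
  - by move: (set22 a b); rewrite -e xE yE !inE orbb eq_sym (negbTE ab).
  - by rewrite rC.
  - by move: (set21 a b); rewrite -e xE yE !inE orbb (negbTE ab).
apply/existsP; exists x; apply/existsP; exists y; rewrite rxy eqxx !andbT.
by apply: contraTN rxy => /eqP->; rewrite rr.
Qed.

End RelGraph.

Definition nbrs (T : finType) (G : sgraph T) (v : T) : {set T} :=
  [set w | adj G v w].

Lemma containsP (S T : finType) (H : sgraph S) (G : sgraph T) :
  reflect (exists2 f : S -> T, injective f &
             forall x y, adj H x y -> adj G (f x) (f y))
          (contains H G).
Proof.
apply: (iffP existsP) => [[f /andP[/injectiveP fI /forallP fP]]|[f fI fP]].
  by exists f => // x y xy; move/forallP: (fP x) => /(_ y)/implyP; apply.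
exists (finfun f); apply/andP; split.
  by apply/injectiveP => x y; rewrite !ffunE => /fI.
apply/forallP => x; apply/forallP => y; rewrite !ffunE; exact/implyP/fP.
Qed.

Section Counting.
Variables (T : finType) (G : sgraph T).
Implicit Types A B U : {set T}.

Lemma cards_sumI A B : #|A :&: B| = \sum_(x in A) (x \in B).
Proof.
rewrite -sum1_card big_mkcond [RHS]big_mkcond; apply: eq_bigr => x _.
by rewrite inE; case: (x \in A); case: (x \in B).
Qed.

(** Double counting of the adjacent pairs with one end in [A] and the other in [B]. *)
Lemma sum_nbrsC A B :
  \sum_(x in A) #|nbrs G x :&: B| = \sum_(y in B) #|nbrs G y :&: A|.
Proof.
under eq_bigr => x _ do rewrite finset.setIC cards_sumI.
under [RHS]eq_bigr => x _ do rewrite finset.setIC cards_sumI.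
rewrite exchange_big; apply: eq_bigr => y _; apply: eq_bigr => x _.
by rewrite !inE adjC.
Qed.

(** Distinct neighbours [w] of [x] give distinct edges [{x, w}] through [x]; after exchanging sums,
    each edge is counted once at each of its two ends. *)
Lemma sum_degree_le : \sum_x degree G x <= 2 * #|edges G|.
Proof.
have degE x : degree G x <= \sum_(e in edges G) (x \in e).
  have inj : {in nbrs G x &, injective (fun w => [set x; w])}.
    move=> w w'; rewrite inE => aw _ e; move: (set22 x w); rewrite e !inE.
    by case/orP=> /eqP // wx; move: aw; rewrite wx adj_irr.
  have -> : degree G x = #|[set [set x; w] | w in nbrs G x]|.
    by rewrite (card_in_imset inj).
  rewrite -sum1_card big_mkcond [leqRHS]big_mkcond; apply: leq_sum => e _.
  case: ifP => // /imsetP[w]; rewrite inE /adj => aw ->.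
  by rewrite aw set21.
apply: (@leq_trans (\sum_x \sum_(e in edges G) (x \in e))).
  by apply: leq_sum => x _; exact: degE.
rewrite exchange_big -[#|_|]sum1_card big_distrr /=; apply: leq_sum => e eG.
have /eqP <- : #|e| == 2 by case: (G) eG => E /forall_inP EP /EP.
by rewrite muln1 -sum1_card [leqRHS]big_mkcond; apply: leq_sum => x _; case: (x \in e).
Qed.

(** The vertices of [U] are renumbered through [enum_val] because [ex_num] ranges over graphs on
    ordinals. *)
Definition induced U : sgraph 'I_#|U| :=
  graph_of_rel (fun i j => adj G (enum_val i) (enum_val j)).

Lemma adj_induced U i j :
  adj (induced U) i j = adj G (enum_val i) (enum_val j).
Proof.
by apply: adj_graph_of_rel => [x y|x]; rewrite ?(adjC G (enum_val x)) ?adj_irr.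
Qed.

Lemma family_free_induced F U : family_free F G -> family_free F (induced U).
Proof.
move=> /allP FG; apply/allP => H HF; apply: contra (FG H HF).
move=> /containsP[f fI fP]; apply/containsP; exists (fun x => enum_val (f x)).
  by move=> x y /enum_val_inj/fI.
by move=> x y /fP; rewrite adj_induced.
Qed.

Lemma degree_induced U i : degree (induced U) i = #|nbrs G (enum_val i) :&: U|.
Proof.
rewrite /degree -(card_imset _ (@enum_val_inj T U)); congr #|pred_of_set _|.
apply/setP => w; rewrite !inE; apply/imsetP/andP => [[j]|[aw wU]].
  by rewrite inE adj_induced => aj ->; rewrite enum_valP.
by exists (enum_rank_in wU w); rewrite ?inE ?adj_induced enum_rankK_in.
Qed.

End Counting.

(** The left side is the degree sum of [induced G U], which is again F-free. *)
Lemma sum_nbrs_le_ex (T : finType) (G : sgraph T) (F : seq graph) (U : {set T}) :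
  family_free F G -> \sum_(x in U) #|nbrs G x :&: U| <= 2 * ex_num #|U| F.
Proof.
move=> FG; rewrite big_enum_val /=.
under eq_bigr => i _ do rewrite -degree_induced.
apply: leq_trans (sum_degree_le _) _; rewrite leq_mul2l.
apply/orP; right; apply: (leq_bigmax_cond (F := fun G' : sgraph 'I_#|U| => #|edges G'|)).
exact: family_free_induced.
Qed.

(** Deleting an element with the least value of [f] never lowers the average of [f]. Starting from
    all of [T], this is repeated until [a] elements remain. *)
Lemma heavy_subset (T : finType) (f : T -> nat) (a : nat) : a <= #|T| ->
  exists2 B : {set T}, #|B| = a & a * \sum_x f x <= #|T| * \sum_(x in B) f x.
Proof.
move=> aT; rewrite -(subKn aT); elim: (#|T| - a) (leq_subr a #|T|) => [|k IH] kT.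
  exists [set: T]; first by rewrite cardsT subn0.
  by rewrite subn0 leq_mul2l; apply/orP; right; under [leqRHS]eq_bigl do rewrite inE.
have [B] := IH (ltnW kT); have -> : #|T| - k = (#|T| - k.+1).+1 by lia.
move: (#|T| - k.+1) => b cB hB.
have [x0 x0B] : exists x, x \in B by apply/set0Pn; rewrite -card_gt0 cB.
case: (arg_minnP f x0B) => x xB' xmin; have xB : x \in B := xB'.
exists (B :\ x); first by move: cB; rewrite (cardsD1 x) xB => -[].
have sB : \sum_(y in B) f y = f x + \sum_(y in B :\ x) f y.
  by rewrite (big_setD1 x xB).
(* The minimum over [B] is at most the average over [B]. *)
have fx : b.+1 * f x <= \sum_(y in B) f y.
  by rewrite -cB -sum_nat_const; apply: leq_sum.
have : b * (b.+1 * \sum_x f x) <= b.+1 * (#|T| * \sum_(y in B :\ x) f y).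
  apply: leq_trans (leq_mul (leqnn b) hB) _; rewrite mulnCA (mulnCA b.+1).
  by rewrite leq_mul2l; apply/orP; right; move: fx; rewrite sB; nia.
by rewrite mulnCA leq_pmul2l.
Qed.

(** Let [v] have least degree in [A], so that at least [#|A| * degree G v] pairs leave [A]. By
    averaging, some [B] of size [#|A|] receives a fraction [#|A| / #|T|] of them, and these pairs
    lie inside the union of [A] and [B], a set of [u] vertices. *)
Lemma low_degree_vertex (T : finType) (G : sgraph T) (F : seq graph)
    (A : {set T}) : family_free F G -> A != finset.set0 ->
  exists2 v, v \in A & exists u,
    [/\ #|A| <= u, u <= 2 * #|A| &
        #|A| * #|A| * degree G v <= #|T| * (2 * ex_num u F)].
Proof.
move=> FG /set0Pn[v0 v0A]; case: (arg_minnP (degree G) v0A) => v vA vmin.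
exists v => //.
have [B cB hB] := heavy_subset (fun w => #|nbrs G w :&: A|) (max_card A).
exists #|A :|: B|; split.
- exact/subset_leq_card/finset.subsetUl.
- by rewrite cardsU cB; lia.
apply: (@leq_trans (#|A| * \sum_w #|nbrs G w :&: A|)).
  rewrite -mulnA leq_mul2l; apply/orP; right.
  have -> : \sum_w #|nbrs G w :&: A| = \sum_(w in A) degree G w.
    transitivity (\sum_(w in [set: T]) #|nbrs G w :&: A|).
      by apply: eq_bigl => w; rewrite inE.
    rewrite sum_nbrsC.
    by apply: eq_bigr => w _; rewrite finset.setIT.
  by rewrite -sum_nat_const; apply: leq_sum.
apply: leq_trans hB _; rewrite leq_mul2l; apply/orP; right.
apply: leq_trans (sum_nbrs_le_ex _ FG).
rewrite [leqRHS]big_mkcond [leqLHS]big_mkcond; apply: leq_sum => w _.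
rewrite inE; case: (w \in B); rewrite ?orbT // subset_leq_card //.
by apply: finset.setIS; exact: finset.subsetUl.
Qed.

(** * Common neighbours *)

Definition max_order (F : seq graph) : nat := \max_(H <- F) tag H.

Lemma le_max_order (F : seq graph) (H : graph) : H \in F -> tag H <= max_order F.
Proof.
by move=> HF; apply: (leq_bigmax_seq (F := fun H' : graph => tag H')).
Qed.

Section CommonNeighbours.
Variables (T : finType) (G : sgraph T).

Definition common_nbrs (A : {set T}) : {set T} :=
  [set w | [forall u in A, adj G u w]].

Lemma common_nbrsP (A : {set T}) w :
  reflect (forall u, u \in A -> adj G u w) (w \in common_nbrs A).
Proof. by rewrite inE; exact: forall_inP. Qed.

Lemma common_nbrsNmem (A : {set T}) w : w \in common_nbrs A -> w \notin A.
Proof. by move=> /common_nbrsP h; apply/negP => /h; rewrite adj_irr. Qed.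

(** All edges of [H] run between [C] and its complement. Hence any injection that sends [C] to [A]
    and the other vertices to common neighbours of [A] is an embedding. *)
Lemma contains_ind_cover (S : finType) (H : sgraph S) (C : {set S})
    (A : {set T}) : ind_cover H C -> #|C| = #|A| -> 0 < #|A| ->
  #|S| <= #|common_nbrs A| -> contains H G.
Proof.
move=> /andP[/forall_inP Cind /forall_inP Ccov] cCA A0 cS.
have [a0 a0A] : exists x, x \in A by apply/set0Pn; rewrite -card_gt0.
(* By [iC] and [iS] both indices are in range, so the default [a0] is never returned. *)
pose f x := if x \in C then nth a0 (enum A) (index x (enum C))
            else nth a0 (enum (common_nbrs A)) (index x (enum S)).
have iC x : x \in C -> index x (enum C) < size (enum A).
  by move=> xC; rewrite -cardE -cCA cardE index_mem mem_enum.
have iS x : index x (enum S) < size (enum (common_nbrs A)).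
  by rewrite -cardE (leq_trans _ cS) // cardE index_mem mem_enum.
have fC x : x \in C -> f x \in A.
  by move=> xC; rewrite /f xC -(mem_enum (mem A)) mem_nth // iC.
have fN x : x \notin C -> f x \in common_nbrs A.
  by move=> /negbTE xC; rewrite /f xC -(mem_enum (mem (common_nbrs A))) mem_nth.
apply/containsP; exists f.
  move=> x y; have [xC|xC] := boolP (x \in C); have [yC|yC] := boolP (y \in C).
  - rewrite /f xC yC => /eqP; rewrite nth_uniq ?enum_uniq ?iC // => /eqP e.
    by apply: (@index_inj _ x (enum C) x y _ _ e); rewrite mem_enum.
  - by move=> e; move: (common_nbrsNmem (fN _ yC)); rewrite -e fC.
  - by move=> e; move: (common_nbrsNmem (fN _ xC)); rewrite e fC.
  - rewrite /f (negbTE xC) (negbTE yC) => /eqP.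
    rewrite nth_uniq ?enum_uniq ?iS // => /eqP e.
    by apply: (@index_inj _ x (enum S) x y _ _ e); rewrite mem_enum.
move=> x y xy; have [xC|xC] := boolP (x \in C); have [yC|yC] := boolP (y \in C).
- by move: (Cind x xC) => /forall_inP/(_ y yC); rewrite xy.
- by move: (fN y yC) => /common_nbrsP/(_ _ (fC x xC)).
- by rewrite adjC; move: (fN x xC) => /common_nbrsP/(_ _ (fC y yC)).
- move: (Ccov [set x; y] xy) => /negP[]; rewrite disjoint_subset.
  by apply/fintype.subsetP => z; rewrite !inE => /orP[]/eqP->.
Qed.

Variable F : seq graph.
Hypotheses (degF : degenerate F) (FG : family_free F G).

(** Otherwise a bipartite member attaining [tau_family F] embeds, its smallest independent cover
    going to [A]. *)
Lemma card_common_nbrs_lt (A : {set T}) :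
  0 < #|A| -> #|A| = tau_family F -> #|common_nbrs A| < max_order F.
Proof.
move=> A0 cA; have [H /andP[HF bH] [tH _]] := tau_familyP degF.
have [C HC [tC _]] := tauP bH.
apply: leq_trans (le_max_order HF); rewrite ltnNge; apply/negP => cN.
move/allP: FG => /(_ H HF)/negP[]; apply: (contains_ind_cover (A := A) HC) => //.
  by rewrite cA tH tC.
by rewrite card_ord.
Qed.

(** The pairs are counted from the other end: a vertex outside [Y] has at most [tau_family F - 1]
    neighbours in [X], and each of the few vertices in [Y] has at most [#|X|]. *)
Lemma sum_degree_le_tau (X : {set T}) : 0 < tau_family F ->
  \sum_(x in X) degree G x <=
    (tau_family F).-1 * #|T| + #|X| * (2 ^ #|X| * max_order F).
Proof.
move=> t0; pose Y := [set w : T | tau_family F <= #|nbrs G w :&: X|].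
(* A vertex of [Y] is a common neighbour of some subset of [X] of size [tau_family F], and [X] has
   at most [2 ^ #|X|] such subsets. *)
have cY : #|Y| <= 2 ^ #|X| * max_order F.
  pose Q := [set S in powerset X | #|S| == tau_family F].
  have YQ : Y \subset \bigcup_(S in Q) common_nbrs S.
    apply/fintype.subsetP => w; rewrite inE => /card_geqP[s [us ss sP]].
    apply/bigcupP; exists [set x in s]; last first.
      apply/common_nbrsP => u; rewrite inE => /sP; rewrite !inE adjC.
      by case/andP.
    rewrite !inE cardsE (card_uniqP us) ss eqxx andbT.
    by apply/fintype.subsetP => u; rewrite inE => /sP; rewrite inE; case/andP.
  apply: leq_trans (subset_leq_card YQ) _.
  apply: (@leq_trans (\sum_(S in Q) max_order F)).
    apply: (big_ind2 (fun (B : {set T}) n => #|B| <= n)); first by rewrite cards0.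
      by move=> B m C n hB hC; rewrite cardsU (leq_trans (leq_subr _ _)) ?leq_add.
    move=> S; rewrite inE => /andP[_ /eqP cS].
    by apply: ltnW; apply: card_common_nbrs_lt; rewrite ?cS.
  rewrite sum_nat_const leq_mul2r -card_powerset subset_leq_card ?orbT //.
  by apply/fintype.subsetP => S; rewrite inE => /andP[].
have -> : \sum_(x in X) degree G x = \sum_w #|nbrs G w :&: X|.
  transitivity (\sum_(x in X) #|nbrs G x :&: [set: T]|).
    by apply: eq_bigr => x _; rewrite finset.setIT.
  by rewrite sum_nbrsC; apply: eq_bigl => w; rewrite inE.
apply: (@leq_trans (\sum_w ((tau_family F).-1 + #|X| * (w \in Y)))).
  apply: leq_sum => w _; rewrite inE; case: (leqP (tau_family F) #|nbrs G w :&: X|) => hw /=.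
    by rewrite muln1 (leq_trans _ (leq_addl _ _)) // subset_leq_card // finset.subsetIr.
  by rewrite muln0 addn0 -ltnS prednK.
rewrite big_split /= sum_nat_const mulnC leq_add2l -big_distrr leq_mul2l /=.
by apply/orP; right; rewrite -big_mkcond sum1_card.
Qed.
End CommonNeighbours.

(** * Redirected and complete bipartite graphs *)

Section Redirect.
Variables (T : finType) (G : sgraph T) (A : {set T}) (v : T).
Hypothesis vA : v \notin A.

Definition redirect_rel : rel T := fun x y =>
  if x == v then y \in A else if y == v then x \in A else adj G x y.

Definition redirect : sgraph T := graph_of_rel redirect_rel.

Lemma adj_redirect : adj redirect =2 redirect_rel.
Proof.
apply: adj_graph_of_rel => [x y|x]; rewrite /redirect_rel.
  case: (eqVneq x v) => [xv|_]; case: (eqVneq y v) => [yv|_] //; last exact: adjC.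
  by rewrite xv yv.
by case: (eqVneq x v) => [->|_]; rewrite ?adj_irr // (negbTE vA).
Qed.

(* A copy using v can be moved to an unused common neighbour of A. *)
Lemma family_free_redirect (F : seq graph) :
  family_free F G -> max_order F < #|common_nbrs G A| -> family_free F redirect.
Proof.
move=> /allP FG cN; apply/allP => H HF; apply/negP => /containsP[f fI fP].
have [w wN wf] : exists2 w, w \in common_nbrs G A & w \notin codom f.
  apply/exists_inP; rewrite -negb_forall_in; apply/negP => /forall_inP Nf.
  move: cN; rewrite ltnNge => /negP[]; apply: leq_trans (le_max_order HF).
  rewrite -[leqRHS]card_ord -(card_codom fI) subset_leq_card //.
  by apply/fintype.subsetP => w /Nf.
move/(_ H HF): FG => /negP[]; apply/containsP.
have fw x : f x != w by apply: contraNneq wf => <-; exact: codom_f.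
(* Since [w] is not a value of [f], the transposition only moves [v] to [w]; if the copy avoids [v],
   nothing moves. *)
exists (fun x => tperm v w (f x)) => [x y /perm_inj/fI //|x y xy].
have mv z : f z != v -> tperm v w (f z) = f z.
  by move=> zv; rewrite tpermD // eq_sym.
have NA z : z \in A -> z != v by move=> zA; apply: contraTneq zA => ->.
move: (fP x y xy); rewrite adj_redirect /redirect_rel /=.
have [xv yA|xv] := eqVneq (f x) v.
  by rewrite (mv y (NA _ yA)) xv tpermL adjC; move/common_nbrsP: wN; apply.
have [yv xA|yv] := eqVneq (f y) v; last by rewrite !mv.
by rewrite (mv x xv) yv tpermL; move/common_nbrsP: wN; apply.
Qed.

Lemma degree_redirect_in w : w \in A ->
  degree G w + ~~ adj G w v <= degree redirect w.
Proof.
move=> wA; have wv : w != v by apply: contraTneq wA => ->.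
have -> : degree redirect w = #|v |: nbrs G w|.
  apply: eq_card => x; rewrite !inE adj_redirect /redirect_rel (negbTE wv).
  by have [->|] := eqVneq x v; rewrite ?wA.
by rewrite cardsU1 inE addnC.
Qed.

Lemma degree_redirect_out w : w \notin A -> w != v ->
  degree G w = adj G v w + degree redirect w.
Proof.
move=> wA wv; rewrite adjC {1}/degree (cardsD1 v) inE; congr (_ + _).
apply: eq_card => x; rewrite !inE adj_redirect /redirect_rel (negbTE wv).
by have [->|] := eqVneq x v; rewrite ?(negbTE wA).
Qed.

End Redirect.

Section BipartiteJoin.
Variables (T : finType) (A : {set T}).

Definition complete_bipartite : sgraph T :=
  graph_of_rel (fun x y => (x \in A) != (y \in A)).

Lemma adj_complete_bipartite x y :
  adj complete_bipartite x y = ((x \in A) != (y \in A)).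
Proof. by rewrite adj_graph_of_rel => [//|x' y'|x']; rewrite ?eqxx // eq_sym. Qed.

Lemma degree_complete_bipartite x :
  x \in A -> degree complete_bipartite x = #|~: A|.
Proof.
by move=> xA; apply: eq_card => y; rewrite !inE adj_complete_bipartite xA; case: (y \in A).
Qed.

(** In a copy of [H], the preimage of [A] is an independent vertex cover of [H] with at most [#|A|]
    vertices; it also provides the 2-colouring that makes [H] bipartite. *)
Lemma family_free_complete_bipartite (F : seq graph) : degenerate F ->
  #|A| < tau_family F -> family_free F complete_bipartite.
Proof.
move=> degF; apply: contraTT => /allPn[H HF /negPn/containsP[f fI fP]].
have [H0 _ [tH0 minH0]] := tau_familyP degF.
have fc x y : adj (tagged H) x y -> (f x \in A) != (f y \in A).
  by move/fP; rewrite adj_complete_bipartite.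
have bH : bipartite (tagged H).
  apply/existsP; exists [ffun x => f x \in A]; apply/forallP => x.
  by apply/forallP => y; rewrite !ffunE; exact/implyP/fc.
have [C _ [tC minC]] := tauP bH.
rewrite -leqNgt tH0; apply: leq_trans (minH0 H HF bH) _; rewrite tC.
have iH : ind_cover (tagged H) (f @^-1: A).
  apply/andP; split.
    apply/forall_inP => x; rewrite inE => xA; apply/forall_inP => y.
    by rewrite inE => yA; apply/negP => /fc; rewrite xA yA.
  apply/forall_inP => e eH.
  have /cards2P[x [y [_ exy]]] : #|e| == 2.
    by case: (tagged H) eH => E /forall_inP EP /EP.
  have /fc xy : adj (tagged H) x y by rewrite /adj -exy.
  rewrite disjoint_subset; apply/subsetPn; case xA: (f x \in A).
    by exists x; [rewrite exy set21|rewrite !inE xA].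
  by exists y; [rewrite exy set22|move: xy; rewrite !inE xA; case: (_ \in A)].
apply: leq_trans (minC _ iH) _.
by rewrite -(card_imset _ fI) subset_leq_card //; apply/fintype.subsetP => z /imsetP[x]; rewrite inE => ? ->.
Qed.

Lemma contains_Kbip (G : sgraph T) (s r : nat) :
  #|A| = s -> #|~: A| = r -> ~: A \subset common_nbrs G A ->
  contains (Kbip s r) G.
Proof.
move=> cA cAC AN; apply/containsP.
pose f (x : 'I_s + 'I_r) := match x with
  | inl i => enum_val (cast_ord (esym cA) i)
  | inr j => enum_val (cast_ord (esym cAC) j) end.
have fA i : f (inl i) \in A by exact: enum_valP.
have fN j : f (inr j) \in ~: A by exact: enum_valP.
exists f.
  case=> i [] j.
  - by move=> /enum_val_inj/cast_ord_inj->.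
  - by move=> e; move: (fN j); rewrite -e inE fA.
  - by move=> e; move: (fN i); rewrite e inE fA.
  - by move=> /enum_val_inj/cast_ord_inj->.
have fadj i j : adj G (f (inl i)) (f (inr j)).
  by have /common_nbrsP/(_ _ (fA i)) := fintype.subsetP AN _ (fN j).
(* An edge of [Kbip] is an unordered pair, so either end may lie on the left; the cases with [x = y]
   contradict [e]. *)
move=> x y /imset2P[i j _ _ e].
have : x \in [set inl i; inr j] by rewrite -e set21.
have : y \in [set inl i; inr j] by rewrite -e set22.
rewrite !inE => /orP[]/eqP yE /orP[]/eqP xE; rewrite xE yE.
- by move: (set22 (inl i) (inr j : 'I_s + 'I_r)); rewrite -e xE yE !inE.
- by rewrite adjC.
- exact: fadj.
- by move: (set21 (inl i : 'I_s + 'I_r) (inr j)); rewrite -e xE yE !inE.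
Qed.

End BipartiteJoin.

(** * Vertices outside the common neighbourhood of a set *)

Section Defect.
Variables (T : finType) (G : sgraph T) (A : {set T}).

(** Union bound over the non-neighbourhoods of the vertices of [A]. *)
Lemma card_common_nbrsC_le :
  #|~: common_nbrs G A| <= \sum_(u in A) (#|T| - degree G u).
Proof.
have -> : ~: common_nbrs G A = \bigcup_(u in A) ~: nbrs G u.
  apply/setP => w; rewrite !inE negb_forall_in; apply/exists_inP/bigcupP.
    by move=> [u uA uw]; exists u; rewrite // !inE.
  by move=> [u uA]; rewrite !inE => uw; exists u.
apply: (big_ind2 (fun (B : {set T}) n => #|B| <= n)); first by rewrite cards0.
  by move=> B m C n hB hC; rewrite cardsU (leq_trans (leq_subr _ _)) ?leq_add.
by move=> u _; rewrite cardsCs finset.setCK.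
Qed.

(** These vertices are the common neighbours of [v |: A], a set of size [tau_family F]. *)
Lemma card_nbrs_common_nbrs_lt (F : seq graph) v : degenerate F ->
  family_free F G -> #|A|.+1 = tau_family F -> v \notin A ->
  #|nbrs G v :&: common_nbrs G A| < max_order F.
Proof.
move=> degF FG cA vA.
have -> : nbrs G v :&: common_nbrs G A = common_nbrs G (v |: A).
  apply/setP => w; rewrite finset.in_setI; apply/andP/common_nbrsP.
    by case; rewrite inE => vw /common_nbrsP wA u /setU1P[->|/wA].
  move=> h; split; first by rewrite inE h // setU11.
  by apply/common_nbrsP => u uA; apply: h; exact: setU1r.
by apply: card_common_nbrs_lt => //; rewrite cardsU1 vA.
Qed.

Lemma degree_le_split w :
  degree G w <= #|A| + #|nbrs G w :&: common_nbrs G A| +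
    #|nbrs G w :&: ~: (A :|: common_nbrs G A)|.
Proof.
rewrite /degree -/(nbrs G w) -(cardsID A (nbrs G w)) -addnA leq_add //.
  exact/subset_leq_card/finset.subsetIr.
rewrite -(cardsID (common_nbrs G A) (_ :\: _)) leq_add // subset_leq_card //.
  by apply/fintype.subsetP => z; rewrite !inE => /andP[/andP[_ ->] ->].
by apply/fintype.subsetP => z; rewrite !inE => /and3P[/negbTE-> /negbTE-> ->].
Qed.

End Defect.

Local Open Scope ring_scope.

(** * Real powers *)

Section RealPowers.
Variable R : realType.
Implicit Types x y c p s : R.

Lemma ge0_powR_le p x y : 0 <= p -> 0 <= x -> x <= y -> x `^ p <= y `^ p.
Proof.
move=> p0 x0 xy; apply: ge0_ler_powR => //; rewrite nnegrE //.
exact: le_trans xy.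
Qed.

Lemma powR_add1_ge p x : 1 <= p -> 0 <= x ->
  x `^ p + x `^ (p - 1) <= (x + 1) `^ p.
Proof.
move=> p1 x0; have p0 : 0 < p by lra.
rewrite -!(@mulr_powRB1 _ _ p) ?addr_ge0 // -{2}[x `^ (p - 1)]mul1r -mulrDl.
by apply: ler_wpM2l; [lra | apply: ge0_powR_le; lra].
Qed.

Lemma bernoulli_le x (k : nat) : 0 <= x <= 1 -> 1 - k%:R * x <= (1 - x) ^+ k.
Proof.
move=> /andP[x0 x1]; elim: k => [|k IH]; first by rewrite mul0r subr0 expr0.
rewrite exprS; apply: (@le_trans _ _ ((1 - x) * (1 - k%:R * x))).
  have : 0 <= k%:R * x * x by rewrite !mulr_ge0.
  by rewrite -natr1; lra.
by apply: ler_wpM2l; first lra.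
Qed.

(** Bernoulli's inequality for [1 - c / y]. An integer [k] above [p] replaces the exponent: this
    only lowers powers of a base in the unit interval, and it makes the induction of [bernoulli_le]
    available. *)
Lemma powR_sub_ge p (k : nat) y c : 0 < p -> p <= k%:R -> 0 < y -> 0 <= c <= y ->
  y `^ p - k%:R * c * y `^ (p - 1) <= (y - c) `^ p.
Proof.
move=> p0 pk y0 /andP[c0 cy].
have -> : y - c = y * (1 - c / y) by rewrite mulrBr mulr1 mulrCA divff ?mulr1 ?gt_eqF.
have z01 : 0 <= c / y <= 1 by rewrite divr_ge0 ?(ltW y0) //= ler_pdivrMr // mul1r.
rewrite powRM ?(ltW y0) ?subr_ge0 ?(andP z01).2 //.
have -> : k%:R * c * y `^ (p - 1) = y `^ p * (k%:R * (c / y)).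
  by rewrite -(@mulr_powRB1 _ y p) ?(ltW y0) //; field; rewrite gt_eqF.
rewrite -{1}[y `^ p]mulr1 -mulrBr; apply: ler_wpM2l; first exact: powR_ge0.
apply: le_trans (bernoulli_le k z01) _.
have [->|u0] := eqVneq (1 - c / y) 0.
  have k0 : (0 < k)%N by rewrite -(ltr_nat R); exact: lt_le_trans pk.
  by rewrite expr0n powR0 ?gt_eqF // eqn0Ngt k0.
by rewrite -powR_mulrn ?subr_ge0 ?(andP z01).2 //; apply: ger_powR => //; lra.
Qed.

Lemma powR_add_le p x y : 0 <= p -> 0 <= x -> 0 <= y ->
  (x + y) `^ p <= 2 `^ p * (x `^ p + y `^ p).
Proof.
move=> p0; wlog xy : x y / x <= y => [hw x0 y0|x0 y0].
  by have [/hw|/ltW/hw] := leP x y; [apply|rewrite addrC [_ `^ p + _]addrC; apply].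
apply: (@le_trans _ _ ((2 * y) `^ p)); first by apply: ge0_powR_le; lra.
rewrite powRM //; apply: ler_wpM2l; first exact: powR_ge0.
by rewrite lerDr powR_ge0.
Qed.

(** Cauchy condensation: bounding the term at 2j+1 by the term at 2j gives
    [S M.*2.+1 <= 1 + q * S M] with [q < 1]. The bound is then the fixed point of z = 1 + qz. *)
Lemma sum_powRN_bounded s : 1 < s ->
  exists2 Z, 0 <= Z & forall N, \sum_(i < N) i.+1%:R `^ (- s) <= Z.
Proof.
move=> s1; pose q : R := 2 `^ (1 - s); pose S N : R := \sum_(i < N) i.+1%:R `^ (- s).
have q0 : 0 < q by exact: powR_gt0.
have q1 : q < 1.
  rewrite /q /powR pnatr_eq0 /= expR_lt1.
  by rewrite nmulr_rlt0; [|lra]; apply: ln_gt0; rewrite ltr1n.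
have Sd M : S M.*2.+1 <= 1 + q * S M.
  elim: M => [|M IH]; first by rewrite /S !big_ord_recr !big_ord0 /= powR1; lra.
  rewrite /S doubleS big_ord_recr big_ord_recr /= -/(S _).
  rewrite [X in 1 + q * X]big_ord_recr /= -/(S M) mulrDr.
  have e : q * M.+1%:R `^ (- s) = 2 * M.*2.+2%:R `^ (- s).
    rewrite -doubleS -mul2n natrM powRM // mulrA; congr (_ * _).
    by rewrite /q powRD ?pnatr_eq0 ?implybT // powRr1.
  have l : M.*2.+3%:R `^ (- s) <= M.*2.+2%:R `^ (- s) :> R.
    rewrite !powRN lef_pV2 ?posrE ?powR_gt0 // ge0_powR_le ?ler_nat //; lra.
  by rewrite e; lra.
exists (1 - q)^-1 => [|N]; first by rewrite invr_ge0; lra.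
have ZE : 1 + q * (1 - q)^-1 = (1 - q)^-1 by field; lra.
elim/ltn_ind: N => N IH; have [->|N0] := posnP N.
  by rewrite big_ord0 invr_ge0; lra.
apply: (@le_trans _ _ (S N./2.*2.+1)).
  rewrite /S -[in leLHS](odd_double_half N); case: (odd N) => //=.
  by rewrite add0n big_ord_recr /= lerDl powR_ge0.
rewrite -ZE; apply: le_trans (Sd _) _; rewrite lerD2l ler_pM2l //.
by apply: IH; rewrite ltn_half_double -addnn -[ltnLHS]addn0 ltn_add2l.
Qed.

End RealPowers.

(** Remove from the current set a vertex given by the hypothesis and repeat; a vertex removed from a
    set of size m is charged to [g] at m - 1. *)
Lemma sum_greedy_le (R : numDomainType) (T : finType) (f : T -> R) (g : nat -> R) :
  (forall A : {set T}, A != finset.set0 -> exists2 v, v \in A & f v <= g #|A|.-1) ->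
  \sum_v f v <= \sum_(i < #|T|) g i.
Proof.
move=> fg; suff h (D : {set T}) : \sum_(v in D) f v <= \sum_(i < #|D|) g i.
  by move: (h [set: T]); rewrite cardsT; under eq_bigl do rewrite inE.
move: {-1}#|D| (erefl #|D|) => m; elim: m D => [|m IH] D cD.
  by rewrite (cards0_eq cD) !big_set0 big_ord0.
have [|v vD fv] := fg D; first by rewrite -card_gt0 cD.
rewrite (big_setD1 v vD) /= big_ord_recr /= addrC lerD //.
  by apply: IH; move: cD; rewrite (cardsD1 v) vD => -[].
by move: fv; rewrite cD.
Qed.

(** * Bounding degree powers *)

Section DegreePowers.
Local Open Scope classical_set_scope.
Local Open Scope ring_scope.
Variables (R : realType) (F : seq graph) (alpha : R).
Hypotheses (alpha_ge0 : 0 <= alpha) (alpha_lt1 : alpha < 1).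
Hypothesis exF : (fun n : nat => (ex_num n F)%:R : R) =O_\oo
                 (fun n : nat => n%:R `^ (1 + alpha) : R).

(** The asymptotic bound only holds from some [N] on. The finitely many smaller values are absorbed
    by their sum [D], because the power of [k] is at least 1. *)
Lemma ex_num_le : exists2 C : R, 0 < C &
  forall k, (0 < k)%N -> (ex_num k F)%:R <= C * k%:R `^ (1 + alpha).
Proof.
have [c c0 [N _ hN]] : exists2 c : R, 0 < c & \forall n \near \oo,
    `|(ex_num n F)%:R : R| <= c * `|n%:R `^ (1 + alpha) : R|.
  by move/eqO_exP: exF.
pose D : R := \sum_(i < N) (ex_num i F)%:R.
have D0 : 0 <= D by exact: sumr_ge0.
exists (c + D) => [|k k0]; first by lra.
have [Nk|kN] := leqP N k.
  move: (hN k Nk) => /=; rewrite normr_nat ger0_norm ?powR_ge0 // => h.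
  by apply: le_trans h _; rewrite ler_wpM2r ?powR_ge0; lra.
have k1 : 1 <= k%:R `^ (1 + alpha) :> R.
  apply: (@le_trans _ _ (1 `^ (1 + alpha))); first by rewrite powR1.
  by rewrite ge0_powR_le ?ler1n // addr_ge0.
apply: (@le_trans _ _ D).
  by rewrite /D (bigD1 (Ordinal kN)) //= lerDl sumr_ge0.
by apply: (@le_trans _ _ (c + D)); [|apply: ler_peMr]; lra.
Qed.

Lemma low_degree_vertex_le : exists2 C : R, 0 < C &
  forall (T : finType) (G : sgraph T) (A : {set T}), family_free F G ->
  A != finset.set0 -> exists2 v, v \in A &
    (degree G v)%:R <= C * #|T|%:R * #|A|%:R `^ (alpha - 1).
Proof.
have [C C0 hC] := ex_num_le; pose C2 : R := 2 * C * 2 `^ (1 + alpha).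
exists C2 => [|T G A FG A0]; first by rewrite !mulr_gt0 ?powR_gt0.
have [v vA [u [Au uA hv]]] := low_degree_vertex FG A0; exists v => //.
have {}A0 : (0 < #|A|)%N by rewrite card_gt0.
have a0 : 0 < #|A|%:R :> R by rewrite ltr0n.
have u0 : (0 < u)%N by exact: leq_trans Au.
have hu : (ex_num u F)%:R <= C * (2 * #|A|%:R) `^ (1 + alpha).
  apply: le_trans (hC u u0) _; rewrite ler_pM2l // ge0_powR_le //; first exact: addr_ge0.
  by rewrite -natrM ler_nat.
have {}hv : #|A|%:R * #|A|%:R * (degree G v)%:R <=
    #|T|%:R * (2 * (ex_num u F)%:R) :> R by rewrite -!natrM ler_nat.
rewrite -(ler_pM2l (mulr_gt0 a0 a0)); apply: le_trans hv _.
have -> : #|A|%:R `^ (alpha - 1) =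
    #|A|%:R `^ (1 + alpha) / (#|A|%:R * #|A|%:R) :> R.
  rewrite -expr2 -powR_mulrn ?ler0n // -powRB ?(gt_eqF a0) ?implybT //.
  by congr (_ `^ _); ring.
rewrite powRM // in hu.
have -> : #|A|%:R * #|A|%:R * (C2 * #|T|%:R *
    (#|A|%:R `^ (1 + alpha) / (#|A|%:R * #|A|%:R))) =
    #|T|%:R * (2 * (C * (2 `^ (1 + alpha) * #|A|%:R `^ (1 + alpha)))).
  by rewrite /C2; field; rewrite gt_eqF.
by rewrite ler_wpM2l // ler_wpM2l.
Qed.

(** In the greedy ordering the degrees are at most [C * #|T|] times i^(alpha - 1) for i = 1, 2, and
    so on. Their p-th powers sum to O(n^p) because (1 - alpha) p > 1 makes the series converge. *)
Lemma degree_power_le p : 1 / (1 - alpha) < p -> exists2 C : R, 0 < C &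
  forall (T : finType) (G : sgraph T), family_free F G ->
  degree_power p G <= C * #|T|%:R `^ p.
Proof.
move=> hp; have [C C0 hC] := low_degree_vertex_le.
have b0 : 0 < 1 - alpha by rewrite subr_gt0.
have s1 : 1 < (1 - alpha) * p by rewrite mulrC -ltr_pdivrMr.
have p0 : 0 < p by apply: lt_trans hp; rewrite divr_gt0.
have [Z Z0 hZ] := sum_powRN_bounded s1.
exists (C `^ p * (Z + 1)) => [|T G FG]; first by rewrite mulr_gt0 ?powR_gt0 //; lra.
pose g i := C `^ p * #|T|%:R `^ p * i.+1%:R `^ (- ((1 - alpha) * p)) : R.
have -> : C `^ p * (Z + 1) * #|T|%:R `^ p = C `^ p * #|T|%:R `^ p * (Z + 1).
  by ring.
apply: (@le_trans _ _ (\sum_(i < #|T|) g i)).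
  apply: sum_greedy_le => A A0; have [v vA hv] := hC T G A FG A0.
  exists v => //; rewrite /g prednK ?card_gt0 //.
  rewrite -mulNr powRrM -!powRM ?mulr_ge0 ?powR_ge0 ?(ltW C0) //.
  by rewrite opprB ge0_powR_le ?(ltW p0).
rewrite -mulr_sumr ler_wpM2l ?mulr_ge0 ?powR_ge0 //.
by apply: le_trans (hZ _) _; lra.
Qed.

End DegreePowers.

(** * Extremal graphs *)

Section Redirection.
Variables (R : realType) (T : finType) (G : sgraph T).
Implicit Types (p : R) (k : nat) (A : {set T}).

Lemma redirect_ineq p k A u v : 1 <= p -> p <= k%:R ->
  v \notin A -> u \in A -> ~~ adj G u v ->
  degree_power p (redirect G A v) <= degree_power p G ->
  (degree G u)%:R `^ (p - 1) <= (degree G v)%:R `^ p +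
    k%:R * \sum_(w in nbrs G v :\: A) (degree G w)%:R `^ (p - 1).
Proof.
move=> p1 pk vA uA uv le; have p0 : 0 <= p by lra.
have k0 : 0 <= k%:R :> R by [].
set G' := redirect G A v in le *.
(* Balance at a single vertex: old power plus gain against new power plus allowed loss. *)
have Hp w : (degree G w)%:R `^ p +
      (if w == u then (degree G u)%:R `^ (p - 1) else 0) <=
    (degree G' w)%:R `^ p + (if w == v then (degree G v)%:R `^ p else 0) +
      (if w \in nbrs G v :\: A then k%:R * (degree G w)%:R `^ (p - 1) else 0).
  have [wA|wA] := boolP (w \in A).
    have wv : w != v by apply: contraTneq wA => ->.
    rewrite (negbTE wv) inE wA /= !addr0.
    have := degree_redirect_in G vA wA; rewrite -/G'.
    have [->|wu] := eqVneq w u.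
      rewrite uv addn1 => du; apply: le_trans (powR_add1_ge p1 (ler0n _ _)) _.
      by rewrite natr1 ge0_powR_le // ler_nat.
    move=> dw; rewrite addr0 ge0_powR_le // ler_nat.
    exact: leq_trans (leq_addr _ _) dw.
  have wu : w != u by apply: contraNneq wA => ->.
  rewrite (negbTE wu) addr0.
  have [->|wv] := eqVneq w v; first by rewrite inE inE adj_irr andbF addr0 lerDr powR_ge0.
  rewrite addr0 !inE wA /= (degree_redirect_out G vA wA wv) -/G'.
  case: (adj G v w) => /=; last by rewrite addr0.
  rewrite add1n -lerBlDr mulrC.
  have := @powR_sub_ge _ p k (degree G' w).+1%:R 1.
  rewrite mulr1 mulrC -natr1 addrK; apply => //; first by lra.
  by rewrite ler01 lerDr ler0n.
have : \sum_w ((degree G w)%:R `^ p +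
      (if w == u then (degree G u)%:R `^ (p - 1) else 0)) <=
    \sum_w ((degree G' w)%:R `^ p + (if w == v then (degree G v)%:R `^ p else 0) +
      (if w \in nbrs G v :\: A then k%:R * (degree G w)%:R `^ (p - 1) else 0)).
  by apply: ler_sum => w _; exact: Hp.
rewrite !big_split /= -!big_mkcond /= !big_pred1_eq -mulr_sumr.
by move: le; rewrite /degree_power; lra.
Qed.

Variables (F : seq graph) (p C : R) (k : nat).
Hypotheses (degF : degenerate F) (FG : family_free F G).
Hypotheses (p1 : 1 < p) (pk : p <= k%:R).
Hypothesis extG : forall G' : sgraph T, family_free F G' ->
  degree_power p G' <= degree_power p G.
Hypothesis powC : forall (S : finType) (G' : sgraph S), family_free F G' ->
  degree_power p G' <= C * #|S|%:R `^ p.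

(** Sum [redirect_ineq] over the bad set [B] and divide by its size [b]. Here [c] bounds the number
    of neighbours outside [B] of a vertex outside [A]. *)
Lemma bad_vertices_ineq (A : {set T}) (x c : R) (b := #|~: (A :|: common_nbrs G A)|) :
  #|A|.+1 = tau_family F -> (max_order F < #|common_nbrs G A|)%N ->
  c = (#|A| + max_order F)%:R -> 0 <= x ->
  (forall u, u \in A -> x <= (degree G u)%:R) -> (0 < b)%N ->
  x `^ (p - 1) <= (1 + k%:R) * 2 `^ p * (C * b%:R `^ (p - 1) + c `^ p) +
    k%:R * (max_order F)%:R * (c + b%:R) `^ (p - 1).
Proof.
move=> cA cW cE x0 hx b0; set W := common_nbrs G A in cW *.
set B := ~: (A :|: W) in b b0 *.
have h1 := p1; have p0 : 0 <= p by lra.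
have pm0 : 0 <= p - 1 by lra.
have k0 : 0 <= k%:R :> R by [].
have c0 : 0 <= c by rewrite cE.
have b0R : 0 < b%:R :> R by rewrite ltr0n.
have NW v : v \notin A -> (#|nbrs G v :&: W| < max_order F)%N.
  exact: card_nbrs_common_nbrs_lt.
have dsplit v : v \notin A ->
    (degree G v <= #|A| + max_order F + #|nbrs G v :&: B|)%N.
  move=> vA; apply: leq_trans (degree_le_split G A v) _.
  by rewrite leq_add2r leq_add2l ltnW // NW.
have BA v : v \in B -> v \notin A by rewrite !inE negb_or => /andP[].
have red v : v \in B -> x `^ (p - 1) <= (degree G v)%:R `^ p +
    k%:R * (\sum_(w in B | adj G v w) (degree G w)%:R `^ (p - 1) +
            \sum_(w in W | adj G v w) (degree G w)%:R `^ (p - 1)).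
  move=> vB; have vA := BA v vB.
  have [u uA uv] : exists2 u, u \in A & ~~ adj G u v.
    apply/exists_inP; rewrite -negb_forall_in; apply/negP => /forall_inP h.
    have vW : v \in W by rewrite /W; apply/common_nbrsP => u /h.
    by move: vB; rewrite finset.in_setC finset.in_setU vW orbT.
  have := redirect_ineq (ltW p1) pk vA uA uv
    (extG (family_free_redirect vA FG cW)).
  have -> : \sum_(w in nbrs G v :\: A) (degree G w)%:R `^ (p - 1) =
      \sum_(w in B | adj G v w) (degree G w)%:R `^ (p - 1) +
      \sum_(w in W | adj G v w) (degree G w)%:R `^ (p - 1) :> R.
    have inN w : (w \in nbrs G v) = adj G v w by rewrite inE.
    rewrite [LHS](bigID (fun w => w \in W)) /= addrC.
    congr (_ + _); apply: eq_bigl => w; rewrite finset.in_setD inN.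
      rewrite finset.in_setC finset.in_setU negb_or.
      by case: (w \in A); case: (w \in W); rewrite ?andbT ?andbF.
    have [/common_nbrsNmem->|] := boolP (w \in W); last by rewrite andbF.
    by rewrite andbT.
  by apply: le_trans; apply: ge0_powR_le => //; exact: hx.
(* After exchanging sums, each [w] in [B] occurs at most [degree G w] times. *)
have sBB : \sum_(v in B) \sum_(w in B | adj G v w) (degree G w)%:R `^ (p - 1)
    <= \sum_(v in B) (degree G v)%:R `^ p :> R.
  under eq_bigr => v _ do rewrite big_mkcondr.
  rewrite exchange_big; apply: ler_sum => w wB.
  rewrite -big_mkcondr sumr_const -(@mulr_powRB1 _ (degree G w)%:R p) //; last lra.
  rewrite -[leLHS]mulr_natl ler_wpM2r ?powR_ge0 // ler_nat subset_leq_card //.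
  by apply/fintype.subsetP => v; rewrite !inE => /andP[_]; rewrite adjC.
(* Each [v] has fewer than [max_order F] neighbours in [W], and each of these has degree at most
   [c + b]. *)
have sBW : \sum_(v in B) \sum_(w in W | adj G v w) (degree G w)%:R `^ (p - 1)
    <= b%:R * ((max_order F)%:R * (c + b%:R) `^ (p - 1)) :> R.
  apply: (@le_trans _ _ (\sum_(v in B) (max_order F)%:R * (c + b%:R) `^ (p - 1))).
    apply: ler_sum => v vB.
    apply: (@le_trans _ _ (\sum_(w in W | adj G v w) (c + b%:R) `^ (p - 1))).
      apply: ler_sum => w /andP[wW _]; apply: ge0_powR_le => //.
      rewrite cE -natrD ler_nat; apply: leq_trans (dsplit w (common_nbrsNmem wW)) _.
      by rewrite leq_add2l subset_leq_card // finset.subsetIr.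
    rewrite sumr_const -[leLHS]mulr_natl ler_wpM2r ?powR_ge0 // ler_nat.
    apply: leq_trans (ltnW (NW v (BA v vB))); rewrite subset_leq_card //.
    by apply/fintype.subsetP => w /andP[wW vw]; rewrite finset.in_setI wW inE vw.
  by rewrite sumr_const -[leLHS]mulr_natl.
(* Degrees split into the part inside [B], where [powC] applies to the induced graph, and at most
   [c] further neighbours. *)
have sB : \sum_(v in B) (degree G v)%:R `^ p <=
    2 `^ p * (C * b%:R `^ p + b%:R * c `^ p) :> R.
  apply: (@le_trans _ _ (\sum_(v in B)
      2 `^ p * (#|nbrs G v :&: B|%:R `^ p + c `^ p))).
    apply: ler_sum => v vB; apply: le_trans (powR_add_le p0 (ler0n _ _) c0).
    by apply: ge0_powR_le => //; rewrite cE -natrD ler_nat addnC dsplit // BA.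
  rewrite -mulr_sumr ler_wpM2l ?powR_ge0 // big_split /= sumr_const -(mulr_natl (c `^ p)).
  rewrite lerD2r; have := powC (family_free_induced B FG).
  rewrite /degree_power card_ord; apply: le_trans; rewrite big_enum_val /=.
  by under [leRHS]eq_bigr => i _ do rewrite degree_induced.
have tot : b%:R * x `^ (p - 1) <= (1 + k%:R) * (2 `^ p * (C * b%:R `^ p + b%:R * c `^ p)) +
    k%:R * (b%:R * ((max_order F)%:R * (c + b%:R) `^ (p - 1))).
  have : \sum_(v in B) x `^ (p - 1) <= \sum_(v in B) ((degree G v)%:R `^ p +
    k%:R * (\sum_(w in B | adj G v w) (degree G w)%:R `^ (p - 1) +
            \sum_(w in W | adj G v w) (degree G w)%:R `^ (p - 1))).
    by apply: ler_sum => v vB; exact: red.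
  rewrite sumr_const -[leLHS]mulr_natl big_split /= -mulr_sumr big_split /=.
  move=> h; apply: le_trans h _; have k1 : 0 <= 1 + k%:R :> R by rewrite addr_ge0.
  have := ler_wpM2l k1 sB; have := ler_wpM2l k0 sBB; have := ler_wpM2l k0 sBW.
  by lra.
rewrite -(ler_pM2l b0R); apply: le_trans tot _; rewrite le_eqVlt; apply/orP; left.
by rewrite -(@mulr_powRB1 _ b%:R p) ?(ltW b0R) //; [apply/eqP; ring | lra].
Qed.

End Redirection.

Lemma exists_nat_ge (R : realType) (x : R) : exists k : nat, x <= k%:R.
Proof.
exists (Num.bound `|x|); apply: le_trans (ler_norm x) _.
exact/ltW/archi_boundP.
Qed.

(** * Finding t vertices of almost full degree *)

Section HighDegree.
Variables (R : realType) (F : seq graph).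

(** Write d^p = d^(p-p') d^p' and bound the first factor by (eps n)^(p-p'). *)
Lemma small_degrees_le (p p' eps C : R) (T : finType) (G : sgraph T) :
  0 < p' -> p' < p -> 0 < eps -> degree_power p' G <= C * #|T|%:R `^ p' ->
  \sum_(v | (degree G v)%:R < eps * #|T|%:R) (degree G v)%:R `^ p
    <= C * eps `^ (p - p') * #|T|%:R `^ p.
Proof.
move=> p'0 p'p e0 hC; set N : R := #|T|%:R in hC *.
have pE x : x `^ p = x `^ (p - p') * x `^ p' :> R.
  by rewrite -powRD ?subrK // (gt_eqF (lt_trans p'0 p'p)).
have N0 : 0 <= N by [].
have pp0 : 0 <= p - p' by lra.
apply: (@le_trans _ _ ((eps * N) `^ (p - p') * degree_power p' G)).
  rewrite big_mkcond /degree_power mulr_sumr; apply: ler_sum => v _.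
  case: ifP => [dv|_]; last by rewrite mulr_ge0 ?powR_ge0.
  by rewrite pE ler_wpM2r ?powR_ge0 // ge0_powR_le // ltW.
rewrite (pE N) powRM ?(ltW e0) // [leRHS](_ : _ =
  eps `^ (p - p') * N `^ (p - p') * (C * N `^ p')); last by ring.
by rewrite ler_wpM2l // mulr_ge0 ?powR_ge0.
Qed.

(** With fewer than t vertices of degree at least (1 - eta) n, these carry at most (t - 1) n of the
    degree sum of [X]. The rest is discounted by the factor 1 - kappa, which costs kappa n^p against
    the maximal main term t n^p. *)
Lemma large_degrees_le (p eta kappa K t : R) (T : finType) (G : sgraph T)
    (X : {set T}) (A := [set v : T | (1 - eta) * #|T|%:R <= (degree G v)%:R]) :
  1 < p -> 0 < eta < 1 -> kappa = 1 - (1 - eta) `^ (p - 1) ->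
  \sum_(v in X) (degree G v)%:R <= t * #|T|%:R + K ->
  #|A|%:R <= t - 1 -> 0 <= K ->
  \sum_(v in X) (degree G v)%:R `^ p <=
    #|T|%:R `^ (p - 1) * (t * #|T|%:R + K - kappa * #|T|%:R).
Proof.
move=> p1 /andP[eta0 eta1] kE hX hA K0; set N : R := #|T|%:R in A hX hA *.
have N0 : 0 <= N by [].
have pm0 : 0 <= p - 1 by lra.
have dN v : (degree G v)%:R <= N by rewrite ler_nat max_card.
have e1 : (1 - eta) `^ (p - 1) <= 1.
  by have := @ge0_powR_le R (p - 1) (1 - eta) 1 pm0; rewrite powR1; apply; lra.
have e0 : 0 <= (1 - eta) `^ (p - 1) by exact: powR_ge0.
(* A degree d < (1 - eta) N loses a factor 1 - kappa against d N^(p-1). *)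
have term v : (degree G v)%:R `^ p <= N `^ (p - 1) *
    ((1 - kappa) * (degree G v)%:R + if v \in A then kappa * N else 0).
  rewrite -(@mulr_powRB1 _ (degree G v)%:R p) //; last lra.
  rewrite inE; case: (lerP ((1 - eta) * N) (degree G v)%:R) => dv.
    rewrite mulrC; apply: ler_pM; rewrite ?powR_ge0 //.
      by apply: ge0_powR_le.
    have : kappa * (degree G v)%:R <= kappa * N by rewrite ler_wpM2l // kE; lra.
    by lra.
  have -> : 1 - kappa = (1 - eta) `^ (p - 1) by rewrite kE; ring.
  rewrite addr0 mulrC mulrA ler_wpM2r // mulrC -powRM //; last by lra.
  by apply: ge0_powR_le => //; exact: ltW.
apply: (@le_trans _ _ (\sum_(v in X) N `^ (p - 1) *
    ((1 - kappa) * (degree G v)%:R + if v \in A then kappa * N else 0))).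
  by apply: ler_sum => v _; exact: term.
rewrite -mulr_sumr ler_wpM2l ?powR_ge0 // big_split /= -mulr_sumr.
have k0 : 0 <= kappa by rewrite kE; lra.
have k1 : 0 <= 1 - kappa by rewrite kE; lra.
have hA' : \sum_(v in X) (if v \in A then kappa * N else 0) <= kappa * N * (t - 1).
  apply: (@le_trans _ _ (\sum_v (if v \in A then kappa * N else 0))).
    rewrite big_mkcond; apply: ler_sum => v _; case: ifP => // _.
    by case: ifP => // _; rewrite mulr_ge0.
  rewrite -big_mkcond sumr_const -[leLHS]mulr_natl mulrC ler_wpM2l //.
  by rewrite mulr_ge0.
apply: le_trans (lerD (ler_wpM2l k1 hX) hA') _.
have : kappa * K >= 0 by rewrite mulr_ge0.
by lra.
Qed.

Variables (alpha p : R).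
Hypotheses (alpha_ge0 : 0 <= alpha) (alpha_lt1 : alpha < 1).
Hypothesis hp : 1 / (1 - alpha) < p.
Hypothesis powC : forall q, 1 / (1 - alpha) < q -> exists2 C : R, 0 < C &
  forall (T : finType) (G : sgraph T), family_free F G ->
  degree_power q G <= C * #|T|%:R `^ q.
Hypotheses (degF : degenerate F) (tauF : (2 <= tau_family F)%N).

Lemma critical_exponent_ge1 : 1 <= 1 / (1 - alpha).
Proof. by rewrite ler_pdivlMr ?subr_gt0 // mul1r lerBlDr lerDl. Qed.

Lemma exponent_gt1 q : 1 / (1 - alpha) < q -> 1 < q.
Proof. exact: le_lt_trans critical_exponent_ge1. Qed.

Lemma high_degree_set (eta : R) : 0 < eta < 1 -> exists n0 : nat,
  forall (T : finType) (G : sgraph T), (n0 <= #|T|)%N -> family_free F G ->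
  (tau_family F).-1%:R * (#|T| - (tau_family F).-1)%:R `^ p <= degree_power p G ->
  exists2 A : {set T}, #|A| = (tau_family F).-1 &
    forall v, v \in A -> (1 - eta) * #|T|%:R <= (degree G v)%:R.
Proof.
move=> eta01; have p1 := exponent_gt1 hp; have hp' := hp.
have p0 : 0 < p by lra.
set t := (tau_family F).-1; set h := max_order F.
(* [p'] lies strictly between the critical exponent and [p]: [powC] still applies to it, and p - p'
   > 0 lets [eps] make the small degrees negligible. *)
pose q := 1 / (1 - alpha); pose p' := (p + q) / 2.
have q1 : 1 <= q := critical_exponent_ge1.
have hq : q < p by [].
have p'p : p' < p by rewrite /p'; lra.
have qp' : q < p' by rewrite /p'; lra.
have p'0 : 0 < p' by lra.
have [C C0 hC] := powC hp; have [C' C'0 hC'] := powC qp'.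
pose kappa := 1 - (1 - eta) `^ (p - 1).
have k0 : 0 < kappa.
  have /andP[? ?] := eta01.
  have : (1 - eta) `^ (p - 1) < 1 `^ (p - 1).
    by apply: gt0_ltr_powR; rewrite ?nnegrE; lra.
  by rewrite powR1 /kappa; lra.
have [eps eps0 epsE] : exists2 eps, 0 < eps & C' * eps `^ (p - p') = kappa / 4.
  have kC : 0 < kappa / (4 * C') by rewrite divr_gt0 // mulr_gt0.
  exists ((kappa / (4 * C')) `^ (p - p')^-1); first exact: powR_gt0.
  by rewrite -powRrM mulVf ?powRr1 ?(ltW kC) //; [field; lra | lra].
(* [M] bounds the number of vertices of degree at least eps n, each of which contributes at least
   (eps n)^p out of C n^p. *)
have [M hM] := exists_nat_ge (C / eps `^ p).
have [k hk] := exists_nat_ge p.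
(* The additive error of [sum_degree_le_tau] for a set of at most [M] vertices. *)
pose K : nat := (M * (2 ^ M * h))%N.
(* From here on kappa n / 2 exceeds the error [K] plus the loss k t^2 in passing from (n - t)^p to
   n^p. *)
have [n0 hn0] := exists_nat_ge ((K%:R + k%:R * t%:R * t%:R) / (kappa / 2)).
exists (n0 + t).+1 => T G nT FG lo.
pose A0 := [set v : T | (1 - eta) * #|T|%:R <= (degree G v)%:R].
(* Any t vertices of [A0] serve; with fewer than t, the upper and lower bounds on the degree power
   collide. *)
have [tA|At] := leqP t #|A0|.
  have [s [us ss sA]] := card_geqP tA.
  exists [set x in s]; first by rewrite cardsE (card_uniqP us).
  by move=> v; rewrite inE => /sA; rewrite inE.
exfalso; set N : R := #|T|%:R in A0 At lo *.
have N0 : 0 < N by rewrite ltr0n; apply: leq_trans nT.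
pose X := [set v : T | eps * N <= (degree G v)%:R].
have cX : (#|X| <= M)%N.
  rewrite -(ler_nat R); apply: le_trans hM.
  rewrite ler_pdivlMr ?powR_gt0 //.
  suff : #|X|%:R * eps `^ p * N `^ p <= C * N `^ p by rewrite ler_pM2r // powR_gt0.
  apply: le_trans (hC T G FG); rewrite -mulrA -powRM ?(ltW eps0) ?(ltW N0) //.
  rewrite mulr_natl -sumr_const /degree_power big_mkcond; apply: ler_sum => v _.
  case: ifP; rewrite ?powR_ge0 // inE => dv.
  by apply: ge0_powR_le => //; rewrite ?mulr_ge0 ?ltW.
have sX : \sum_(v in X) (degree G v)%:R <= t%:R * N + K%:R :> R.
  rewrite -natr_sum -natrM -natrD ler_nat.
  apply: leq_trans (sum_degree_le_tau degF FG X (ltnW tauF)) _.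
  rewrite leq_add2l; apply: (leq_mul cX).
  by rewrite leq_mul2r leq_exp2l // cX orbT.
have At' : #|A0|%:R <= t%:R - 1 :> R by rewrite lerBrDr natr1 ler_nat.
have up1 := large_degrees_le p1 eta01 (erefl kappa) sX At' (ler0n _ _).
have up2 := small_degrees_le p'0 p'p eps0 (hC' T G FG).
have up : degree_power p G <= N `^ (p - 1) * (t%:R * N + K%:R - kappa * N) +
    kappa / 4 * N `^ p.
  rewrite -epsE; apply: le_trans (lerD up1 up2).
  rewrite /degree_power (bigID (mem X)) /= lerD2l le_eqVlt; apply/orP; left.
  by apply/eqP; apply: eq_bigl => v; rewrite inE ltNge.
have tN : (t <= #|T|)%N by apply: leq_trans (ltnW nT); exact: leq_addl.
have lo2 := @powR_sub_ge R p k N t%:R p0 hk N0.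
rewrite ler0n ler_nat tN /= -natrB // in lo2.
have {}lo2 := ler_wpM2l (ler0n R t) (lo2 isT).
have := le_trans (le_trans lo2 lo) up.
rewrite -(@mulr_powRB1 _ N p) ?(ltW N0) //.
set P := N `^ (p - 1); have P0 : 0 < P by exact: powR_gt0.
have -> : t%:R * (N * P - k%:R * t%:R * P) = P * (t%:R * N - k%:R * t%:R * t%:R).
  by ring.
have -> : P * (t%:R * N + K%:R - kappa * N) + kappa / 4 * (N * P) =
  P * (t%:R * N + K%:R - kappa * N + kappa / 4 * N) by ring.
rewrite ler_pM2l //.
have hN : n0%:R + 1 <= N by rewrite natr1 ler_nat; apply: leq_trans nT; rewrite ltnS leq_addr.
move: hn0; rewrite ler_pdivrMr ?divr_gt0 // => hn0.
have := ler_wpM2r (ltW (divr_gt0 k0 (ltr0n R 2))) hN.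
have : 0 < kappa * N by rewrite mulr_gt0.
by lra.
Qed.

End HighDegree.

Lemma exists_subset_card (T : finType) (m : nat) :
  (m <= #|T|)%N -> exists A : {set T}, #|A| = m.
Proof.
rewrite -cardsT => /card_geqP[s [us ss _]]; exists [set x in s].
by rewrite cardsE (card_uniqP us).
Qed.

(** Only the vertices of [A] are counted; this is the competitor that an extremal graph must
    beat. *)
Lemma degree_power_complete_bipartite_ge (R : realType) (p : R) (T : finType)
    (A : {set T}) :
  #|A|%:R * (#|T| - #|A|)%:R `^ p <= degree_power p (complete_bipartite A).
Proof.
rewrite mulr_natl -sumr_const /degree_power big_mkcond; apply: ler_sum => v _.
case: ifP => vA; last exact: powR_ge0.
by rewrite degree_complete_bipartite // (cardsCs (~: A)) finset.setCK.
Qed.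

(** * Extremality leaves no bad vertices *)

Section Stability.
Variables (R : realType) (F : seq graph) (p C : R).
Hypotheses (degF : degenerate F) (tauF : (2 <= tau_family F)%N) (p1 : 1 < p).
Hypothesis C0 : 0 < C.
Hypothesis powC : forall (S : finType) (G' : sgraph S), family_free F G' ->
  degree_power p G' <= C * #|S|%:R `^ p.

Lemma joined_of_high_degree : exists2 eta : R, 0 < eta < 1 & exists n0 : nat,
  forall (T : finType) (G : sgraph T) (A : {set T}), (n0 <= #|T|)%N ->
  family_free F G ->
  (forall G' : sgraph T, family_free F G' ->
     degree_power p G' <= degree_power p G) ->
  #|A|.+1 = tau_family F ->
  (forall u, u \in A -> (1 - eta) * #|T|%:R <= (degree G u)%:R) ->
  ~: A \subset common_nbrs G A.
Proof.
have h1 := p1; have hC0 := C0; have pm0 : 0 < p - 1 by lra.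
have [k pk] := exists_nat_ge p.
pose t := (tau_family F).-1; pose h := max_order F.
have t1 : 1 <= t%:R :> R by rewrite ler1n -ltnS prednK // ltnW.
(* [D] collects the coefficients in [bad_vertices_ineq]; [1 <= D] is what gives [r <= 1] below. *)
have [D D1 DE] : exists2 D, 1 <= D &
    (1 + k%:R) * 2 `^ p * (C + 1) + k%:R * h%:R = D.
  exists ((1 + k%:R) * 2 `^ p * (C + 1) + k%:R * h%:R) => //.
  have q1 : 1 <= 2 `^ p :> R.
    have := @ge0_powR_le R p 1 2; rewrite powR1; apply; lra.
  have a1 : 1 <= (1 + k%:R) * 2 `^ p * (C + 1) by rewrite !mulr_ege1 ?lerDl //; lra.
  by have : 0 <= k%:R * h%:R :> R by []; lra.
(* With b <= r N / 4 the bound on bad vertices reads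
   (N/2)^(p-1) <= D r^(p-1) (N/2)^(p-1), so r halves the right-hand side. *)
have [r [r0 r1 rE]] : exists r : R, [/\ 0 < r, r <= 1 & r `^ (p - 1) = (2 * D)^-1].
  have D2 : 0 < (2 * D)^-1 by rewrite invr_gt0; lra.
  exists ((2 * D)^-1 `^ (p - 1)^-1); split; first exact: powR_gt0.
    have := @ge0_powR_le R (p - 1)^-1 (2 * D)^-1 1; rewrite powR1; apply.
    - by rewrite invr_ge0 ltW.
    - exact: ltW.
    - by rewrite invf_le1; lra.
  by rewrite -powRrM mulVf ?powRr1 ?(ltW D2) // gt_eqF.
(* Chosen so that the t vertices of [A] together miss at most t eta n = r n / 4 vertices. *)
pose eta := r / (4 * t%:R).
have etaE : t%:R * eta = r / 4 by rewrite /eta; field; lra.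
have eta0 : 0 < eta by rewrite divr_gt0 //; lra.
have eta4 : eta <= 1 / 4.
  by have := ler_wpM2r (ltW eta0) t1; rewrite mul1r etaE; lra.
exists eta; first by lra.
pose c : R := (t + h)%:R.
have c0 : 0 <= c by [].
(* Once L <= y = r n / 2, the term 2c yields c + b <= y, and the other term yields c^p <=
   y^(p-1). *)
pose L := 2 * c + c `^ (p / (p - 1)).
have [n2 hn2] := exists_nat_ge (2 * L / r).
(* The summand [2 * h] makes the common neighbourhood, of size at least 3n/4, larger than [h]. *)
exists (n2 + 2 * h)%N.+1 => T G A nT FG extG cA hA.
have {}cA' : #|A| = t by rewrite /t -cA.
pose N : R := #|T|%:R; rewrite -/N in hA.
have N0 : 0 < N by rewrite ltr0n; apply: leq_trans nT.
have n2N : n2%:R <= N.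
  by rewrite ler_nat; apply: leq_trans (ltnW nT); exact: leq_addr.
have LN : 2 * L <= r * N.
  by rewrite [r * N]mulrC -ler_pdivrMr //; apply: le_trans n2N.
have hN : 2 * h%:R < N by rewrite -natrM ltr_nat; apply: leq_trans nT; rewrite ltnS leq_addl.
have cWC : #|~: common_nbrs G A|%:R <= r / 4 * N.
  apply: (@le_trans _ _ (\sum_(u in A) eta * N)).
    apply: le_trans (_ : (\sum_(u in A) (#|T| - degree G u))%:R <= _).
      by rewrite ler_nat card_common_nbrsC_le.
    rewrite natr_sum; apply: ler_sum => u uA.
    by rewrite natrB ?max_card //; have := hA u uA; rewrite -/N; lra.
  by rewrite sumr_const -[leLHS]mulr_natl cA' mulrA etaE.
have cW : (max_order F < #|common_nbrs G A|)%N.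
  have := cardsC (common_nbrs G A) => /(congr1 (fun m : nat => m%:R : R)).
  rewrite natrD -/N -(ltr_nat R) -/h => e.
  have := ler_wpM2r (ltW N0) r1.
  by lra.
pose b := #|~: (A :|: common_nbrs G A)|.
have bN : b%:R <= r / 4 * N.
  apply: le_trans cWC; rewrite ler_nat subset_leq_card //.
  by rewrite finset.setCS finset.subsetUr.
have [b0|b0] := posnP b.
  have e : ~: (A :|: common_nbrs G A) = finset.set0 by exact: cards0_eq.
  apply/fintype.subsetP => v; rewrite finset.in_setC => vA.
  by apply: contraT => vW; have := finset.in_set0 v; rewrite -e finset.in_setC finset.in_setU negb_or vA vW.
exfalso.
have x0 : 0 <= (1 - eta) * N by rewrite mulr_ge0 ?(ltW N0) //; lra.
have := bad_vertices_ineq degF FG p1 pk extG powC cA cW (erefl _) x0 hA b0.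
rewrite cA' -/c -/b -/h.
pose y := r * (N / 2); have y0 : 0 <= y by rewrite mulr_ge0 ?ltW ?divr_gt0.
have L0 : 0 <= c `^ (p / (p - 1)) by exact: powR_ge0.
have cp : c `^ p <= y `^ (p - 1).
  have -> : c `^ p = (c `^ (p / (p - 1))) `^ (p - 1).
    by rewrite -powRrM divfK // gt_eqF.
  by apply: ge0_powR_le; rewrite ?(ltW pm0) //; move: LN; rewrite /L /y; lra.
have bpy : b%:R `^ (p - 1) <= y `^ (p - 1).
  apply: ge0_powR_le; rewrite ?(ltW pm0) //.
  by apply: le_trans bN _; rewrite /y; have := mulr_gt0 r0 N0; lra.
have cbpy : (c + b%:R) `^ (p - 1) <= y `^ (p - 1).
  apply: ge0_powR_le; rewrite ?(ltW pm0) ?addr_ge0 //.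
  by move: LN; rewrite /L /y; lra.
have yE : y `^ (p - 1) = (2 * D)^-1 * (N / 2) `^ (p - 1).
  by rewrite (powRM _ (ltW r0)) ?rE // divr_ge0 // ltW.
have xge : (N / 2) `^ (p - 1) <= ((1 - eta) * N) `^ (p - 1).
  apply: ge0_powR_le; rewrite ?(ltW pm0) ?divr_ge0 ?(ltW N0) //.
  by have := ler_wpM2r (ltW N0) eta4; lra.
move=> hx; have {}hx := le_trans xge hx.
have ub : (1 + k%:R) * 2 `^ p * (C * b%:R `^ (p - 1) + c `^ p) +
    k%:R * h%:R * (c + b%:R) `^ (p - 1) <= D * y `^ (p - 1).
  rewrite -DE [leRHS]mulrDl; apply: lerD; last by rewrite ler_wpM2l // mulr_ge0.
  rewrite -[leRHS]mulrA ler_wpM2l ?mulr_ge0 ?powR_ge0 ?addr_ge0 // [leRHS]mulrDl mul1r.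
  by rewrite lerD // ler_wpM2l // ltW.
have {hx ub} := le_trans hx ub.
rewrite yE mulrA (_ : D * (2 * D)^-1 = 1 / 2); last by field; lra.
have : 0 < (N / 2) `^ (p - 1) by rewrite powR_gt0 // divr_gt0.
by lra.
Qed.

End Stability.

(** * Assembling the theorem *)

Local Open Scope classical_set_scope.
Local Open Scope ring_scope.

Theorem theorem1p3 (R : realType) (F : seq graph) (alpha p : R)
  (degF : degenerate F)
  (alpha_ge0 : 0 <= alpha) (alpha_lt1 : alpha < 1)
  (exF : (fun n : nat => (ex_num n F)%:R : R) =O_\oo
         (fun n : nat => n%:R `^ (1 + alpha) : R))
  (tauF : (2 <= tau_family F)%N)
  (hp : 1 / (1 - alpha) < p) :
  exists n0 : nat, forall n : nat, (n0 <= n)%N ->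
  forall G : sgraph 'I_n, family_free F G ->
  degree_power p G = ex_pow p n F ->
  contains (Kbip (tau_family F - 1) (n - tau_family F + 1)) G.
Proof.
have powC := degree_power_le alpha_ge0 alpha_lt1 exF.
have p1 := exponent_gt1 alpha_ge0 alpha_lt1 hp.
have [C C0 hC] := powC p hp.
have [eta eta01 [n1 joined]] := joined_of_high_degree degF tauF p1 C0 hC.
have [n2 high] := high_degree_set alpha_ge0 alpha_lt1 hp powC degF tauF eta01.
exists (n1 + n2 + tau_family F)%N => n nn0 G FG /(ex_powP p FG) extG.
have n1n : (n1 <= #|'I_n|)%N.
  by rewrite card_ord; apply: leq_trans nn0; rewrite -addnA leq_addr.
have n2n : (n2 <= #|'I_n|)%N.
  by rewrite card_ord; apply: leq_trans nn0; rewrite addnAC leq_addl.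
have tn : (tau_family F <= n)%N by apply: leq_trans nn0; exact: leq_addl.
have t0 : (0 < tau_family F)%N by exact: ltnW.
have [A1 cA1] : exists A : {set 'I_n}, #|A| = (tau_family F).-1.
  by apply: exists_subset_card; rewrite card_ord (leq_trans (leq_pred _)).
(* The complete bipartite graph with sides t and n - t is F-free, so extremality gives the lower
   bound that [high] requires. *)
have lo : (tau_family F).-1%:R * (#|'I_n| - (tau_family F).-1)%:R `^ p
    <= degree_power p G.
  rewrite -cA1; apply: le_trans (degree_power_complete_bipartite_ge _ _) (extG _ _).
  by apply: family_free_complete_bipartite => //; rewrite cA1 prednK.
have [A cA hA] := high _ G n2n FG lo.
have cA' : #|A|.+1 = tau_family F by rewrite cA prednK.
apply: (contains_Kbip (A := A)); first by rewrite cA subn1.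
  (* With truncated subtraction, the identity n - (tau - 1) = n - tau + 1 uses [tn]. *)
  by rewrite (cardsCs (~: A)) finset.setCK card_ord cA -subn1 subnBA // addn1 -addn1 addnBAC.
exact: joined n1n FG extG cA' hA.
Qed.
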